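(* Let $k$ be a field, $R=k[x_1,\dots,x_n]$, and let $I\subseteq R$ be the edge ideal of a graph $\mathcal H$ on the vertex set $V=\{1,\dots,n\}$. For a cover $C$ of $\mathcal H$, the prime ideal $P_C=(x_i\mid i\in C)$ is an associated prime of $I^2$ (that is, of $R/I^2$) if and only if $C$ is a minimal cover of $\mathcal H$ or there is a triangle $U$ of $\mathcal H$ such that $C$ is minimal (with respect to inclusion) among the covers of $\mathcal H$ containing $N(U)$.
   Context: A graph on $V$ is a collection of 2-element subsets of $V$ (edges). The edge ideal of $\mathcal H$ is the ideal of $R$ generated by all $x_ix_j$ with $\{i,j\}\in\mathcal H$. A cover of $\mathcal H$ is a set $C\subseteq V$ meeting every edge; minimal covers are minimal with respect to inclusion. A triangle of $\mathcal H$ here means the set $U$ of the three vertices of a triangle (three pairwise adjacent vertices). For $U\subseteq V$, the neighborhood $N(U)$ is the set of all vertices which are adjacent to some vertex of $U$ (so $U\subseteq N(U)$ when $U$ is a triangle). *)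

(* Defs.v *)
From mathcomp Require Import all_boot all_order all_algebra.
From mathcomp Require Import mpoly.

Set Implicit Arguments.
Unset Strict Implicit.
Unset Printing Implicit Defensive.

Import GRing.Theory.
Local Open Scope ring_scope.

(* Subsets of a ring are Prop-valued predicates: the ideals of ring_quotient
   are decidable (bool-valued), too restrictive for arbitrary ideals. *)
Section Ideals.
Variable A : comNzRingType.
Implicit Types I J P G : A -> Prop.

Definition is_ideal I : Prop :=
  [/\ I 0,
      forall f g, I f -> I g -> I (f + g)
    & forall a f, I f -> I (a * f)].

Definition prime_ideal P : Prop :=
  [/\ is_ideal P,
      ~ P 1
    & forall f g, P (f * g) -> P f \/ P g].

Definition ideal_gen G : A -> Prop := fun f =>
  exists s : seq (A * A),
    (forall ag, ag \in s -> G ag.2) /\ f = \sum_(ag <- s) ag.1 * ag.2.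

Definition ideal_mul I J : A -> Prop :=
  ideal_gen (fun h => exists f g, [/\ I f, J g & h = f * g]).

Fixpoint ideal_pow I (m : nat) : A -> Prop :=
  if m is m'.+1 then ideal_mul I (ideal_pow I m') else fun _ => True.

(* P is an associated prime of the A-module A / J: it is prime and is the
   annihilator of the class of some f, where g annihilates the class of f
   exactly when g * f lies in J. *)
Definition associated_prime J P : Prop :=
  prime_ideal P /\ exists f, forall g, P g <-> J (g * f).

End Ideals.

(* The vertex set {1, ..., n} is rendered as 'I_n = {0, ..., n - 1}. *)
Section Graphs.
Variable n : nat.
Implicit Types (H : {set {set 'I_n}}) (C S U : {set 'I_n}).

Definition is_graph H : bool := [forall e in H, #|e| == 2%N].

(* When H is a graph, this forces i != j, since [set i; i] has one element. *)
Definition adjacent H (i j : 'I_n) : bool := [set i; j] \in H.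

Definition is_cover H C : bool := [forall e in H, C :&: e != set0].

Definition is_triangle H U : bool :=
  (#|U| == 3%N) &&
  [forall i in U, forall j in U, (i != j) ==> adjacent H i j].

Definition neighborhood H U : {set 'I_n} :=
  [set j | [exists i in U, adjacent H i j]].

Definition minimal_cover H C : bool := minset (is_cover H) C.

Definition minimal_cover_containing H S C : bool :=
  minset (fun D : {set 'I_n} => is_cover H D && (S \subset D)) C.

Definition edge_ideal (k : fieldType) H : {mpoly k[n]} -> Prop :=
  ideal_gen (fun g => exists i j, adjacent H i j /\ g = 'X_i * 'X_j).

Definition variable_ideal (k : fieldType) C : {mpoly k[n]} -> Prop :=
  ideal_gen (fun g => exists2 i, i \in C & g = 'X_i).

End Graphs.

Arguments edge_ideal {n} k H _.
Arguments variable_ideal {n} k C _.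

(* Main.v *)
(* Both ideals are monomial, so P_C is associated to I^2 iff there is a single
   monomial m outside I^2 with x_i * m in I^2 for every i in C, and one may
   multiply m by x_d^2 for every d outside C, since no vertex occurs more than
   twice in a product of two edges.  Then x_i * m lies in I^2 iff i is adjacent
   to some vertex j such that x_j times an edge divides m.  If some such j lies
   in C, the condition at j itself forces m to be squarefree on a triangle
   through j; any further edge of the support of m disjoint from an edge of
   the triangle would put m in I^2, so N(U) is contained in C, and every other
   vertex of C has a neighbour outside C.  The witnesses are
   x_c * prod_(d outside C) x_d^2 for a minimal cover, and
   prod_(u in U) x_u * prod_(d outside C) x_d^2 for a triangle U. *)
Require Import Defs.
From mathcomp Require Import all_boot all_order all_algebra.
From mathcomp Require Import mpoly.
From mathcomp Require Import ring zify.

Set Implicit Arguments.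
Unset Strict Implicit.
Unset Printing Implicit Defensive.

Import GRing.Theory.
Local Open Scope ring_scope.

(** * Ideals given by generators *)

Lemma ideal_gen_mem (A : comNzRingType) (G : A -> Prop) g :
  G g -> ideal_gen G g.
Proof.
move=> Gg; exists [:: (1, g)]; rewrite big_seq1 mul1r; split=> // ag.
by rewrite inE => /eqP ->.
Qed.

Lemma ideal_gen_is_ideal (A : comNzRingType) (G : A -> Prop) :
  is_ideal (ideal_gen G).
Proof.
split=> [|f g [s [Gs ->]] [t [Gt ->]]|a f [s [Gs ->]]].
- by exists [::]; rewrite big_nil.
- exists (s ++ t); rewrite big_cat; split=> // ag.
  by rewrite mem_cat => /orP[/Gs|/Gt].
exists [seq (a * ag.1, ag.2) | ag <- s]; split=> [ag /mapP[bg /Gs ? ->] //|].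
by rewrite big_map mulr_sumr; apply: eq_bigr => ag _; rewrite mulrA.
Qed.

Lemma ideal_sum (A : comNzRingType) (J : A -> Prop) (T : eqType) (s : seq T)
    (P : pred T) (F : T -> A) :
    is_ideal J -> (forall x, x \in s -> P x -> J (F x)) ->
  J (\sum_(x <- s | P x) F x).
Proof.
move=> [J0 JD _] JF; rewrite big_seq_cond.
by apply: (big_ind J) => // x /andP[/JF].
Qed.

Lemma ideal_gen_min (A : comNzRingType) (G J : A -> Prop) :
    is_ideal J -> (forall g, G g -> J g) -> forall f, ideal_gen G f -> J f.
Proof.
move=> idJ GJ f [s [Gs ->]]; apply: ideal_sum => // ag /Gs /GJ Jg _.
by case: idJ => _ _; apply.
Qed.

(** [ideal_pow _ 2] unfolds to $I(IA)$ with $A$ the whole ring, so the second factor is first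
    brought back into $I$. Then one factor is fixed at a time, since the [a] with [a * h] in [J]
    form an ideal. *)
Lemma ideal_pow2_min (A : comNzRingType) (G : A -> Prop) (J : A -> Prop) :
    is_ideal J -> (forall g h, G g -> G h -> J (g * h)) ->
  forall f, ideal_pow (ideal_gen G) 2 f -> J f.
Proof.
move=> idJ GJ; have [J0 JD JM] := idJ.
apply: ideal_gen_min => // _ [f [g [If Ig ->]]].
have{Ig} Ig : ideal_gen G g.
  apply: (ideal_gen_min _ _ Ig) => [|_ [a [b [Ia _ ->]]]].
    exact: ideal_gen_is_ideal.
  by rewrite mulrC; case: (ideal_gen_is_ideal G) => _ _; apply.
have idl h : is_ideal (fun a => J (a * h)).
  split=> [|a b|a b]; first by rewrite mul0r.
    by rewrite mulrDl; apply: JD.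
  by rewrite -mulrA; apply: JM.
apply: (ideal_gen_min (idl g) _ If) => a Ga; rewrite mulrC.
by apply: (ideal_gen_min (idl a) _ Ig) => b Gb; rewrite mulrC; apply: GJ.
Qed.

(** * Monomial ideals through supports *)

Section MonomialIdeals.
Variables (R : comNzRingType) (n : nat).
Implicit Types (f g : {mpoly R[n]}) (m w : 'X_{1..n}) (M : pred 'X_{1..n}).

Lemma all_msuppM M M1 M2 f g :
    (forall m1 m2, M1 m1 -> M2 m2 -> M (m1 + m2)%MM) ->
  all M1 (msupp f) -> all M2 (msupp g) -> all M (msupp (f * g)).
Proof.
move=> M12 /allP Mf /allP Mg; apply/allP => m /msuppM_le /allpairsP[[m1 m2] /=].
by case=> /Mf ? /Mg ? ->; apply: M12.
Qed.

Lemma monomial_ideal_is_ideal M :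
    (forall w m, M m -> M (w + m)%MM) ->
  is_ideal (fun f => all M (msupp f)).
Proof.
move=> upM; split=> [|f g /allP Mf /allP Mg|f g].
- by rewrite msupp0.
- by apply/allP => m /msuppD_le; rewrite mem_cat => /orP[/Mf|/Mg].
by apply: all_msuppM (all_predT _) => w m _; apply: upM.
Qed.

Lemma ideal_monomials (J : {mpoly R[n]} -> Prop) f :
  is_ideal J -> (forall m, m \in msupp f -> J 'X_[m]) -> J f.
Proof.
move=> idJ Jf; rewrite [f]mpolyE; apply: ideal_sum => // m /Jf Jm _.
by rewrite -mul_mpolyC; case: idJ => _ _; apply.
Qed.

End MonomialIdeals.

(** * Membership in $P_C$ and $I^2$ read off exponents *)

Definition meets n (C : {set 'I_n}) (m : 'X_{1..n}) : bool :=
  [exists i in C, m i != 0%N].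

(** The sum of the four booleans is the exponent of [x] in the product of two edge monomials, so
    this is divisibility of $x^m$ by such a product; the two edges may coincide. *)
Definition two_edges_le n (H : {set {set 'I_n}}) (m : 'I_n -> nat) : bool :=
  [exists i, exists j, exists k, exists l,
    [&& adjacent H i j, adjacent H k l
      & [forall x, ((i == x) + (j == x) + (k == x) + (l == x) <= m x)%N]]].

Lemma two_edges_leP n (H : {set {set 'I_n}}) (m : 'I_n -> nat) :
  reflect (exists i j k l, [/\ adjacent H i j, adjacent H k l
    & forall x, ((i == x) + (j == x) + (k == x) + (l == x) <= m x)%N])
    (two_edges_le H m).
Proof.
apply: (iffP existsP) => [[i /existsP[j /existsP[k /existsP[l]]]]|].
  by case/and3P=> ij kl /forallP le_m; exists i, j, k, l.
move=> [i [j [k [l [ij kl le_m]]]]]; exists i.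
apply/existsP; exists j; apply/existsP; exists k; apply/existsP; exists l.
by rewrite ij kl; apply/forallP.
Qed.

Lemma two_edges_leS n (H : {set {set 'I_n}}) (m m' : 'I_n -> nat) :
  (forall x, m x <= m' x)%N -> two_edges_le H m -> two_edges_le H m'.
Proof.
move=> mm' /two_edges_leP[i [j [k [l [ij kl le_m]]]]].
apply/two_edges_leP; exists i, j, k, l; split=> // x.
exact: leq_trans (le_m x) (mm' x).
Qed.

Lemma adjacent_neq n (H : {set {set 'I_n}}) i j :
  is_graph H -> adjacent H i j -> i != j.
Proof. by move=> /forall_inP gH /gH; rewrite cards2 eqSS eqb1. Qed.

Lemma adjacent_sym n (H : {set {set 'I_n}}) i j :
  adjacent H i j = adjacent H j i.
Proof. by rewrite /adjacent setUC. Qed.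

Lemma variable_idealE (k : fieldType) n (C : {set 'I_n}) (f : {mpoly k[n]}) :
  variable_ideal k C f <-> all (meets C) (msupp f).
Proof.
split.
  apply: (ideal_gen_min (J := fun g => all (meets C) (msupp g))).
    apply: monomial_ideal_is_ideal => w m /exists_inP[i iC mi0].
    by apply/exists_inP; exists i; rewrite // mnmDE addn_eq0 negb_and mi0 orbT.
  move=> _ [i iC ->].
  rewrite msuppX /= andbT; apply/exists_inP; exists i => //.
  by rewrite mnm1E eqxx.
move/allP => Mf; apply: ideal_monomials => [|m /Mf /exists_inP[i iC mi0]].
  exact: ideal_gen_is_ideal.
rewrite -lep1mP in mi0; rewrite -(submK mi0) mpolyXD.
have [_ _ PM] : is_ideal (variable_ideal k C) by apply: ideal_gen_is_ideal.
by apply/PM/ideal_gen_mem; exists i.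
Qed.

Lemma edge_ideal_squareE (k : fieldType) n (H : {set {set 'I_n}})
    (f : {mpoly k[n]}) :
  ideal_pow (edge_ideal k H) 2 f <->
  all (fun m : 'X_{1..n} => two_edges_le H m) (msupp f).
Proof.
set M := fun m : 'X_{1..n} => _.
have XE (i j a b : 'I_n) :
    'X_i * 'X_j * ('X_a * 'X_b) = 'X_[U_(i) + U_(j) + (U_(a) + U_(b))]
      :> {mpoly k[n]}.
  by rewrite !mpolyXD.
split.
  apply: (ideal_pow2_min (J := fun g => all M (msupp g))).
    apply: monomial_ideal_is_ideal => w m; apply: two_edges_leS => x.
    by rewrite mnmDE leq_addl.
  move=> _ _ [i [j [ij ->]]] [a [b [ab ->]]].
  rewrite XE msuppX /= andbT; apply/two_edges_leP; exists i, j, a, b.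
  by split=> // x; rewrite !mnmDE !mnm1E addnA.
move/allP => Mf; apply: ideal_monomials => [|m /Mf /two_edges_leP].
  exact: ideal_gen_is_ideal.
case=> i [j [a [b [ij ab le_m]]]].
have {}le_m : (U_(i) + U_(j) + (U_(a) + U_(b)) <= m)%MM.
  by apply/mnm_lepP => x; rewrite !mnmDE !mnm1E addnA.
have -> : 'X_[m] = 'X_[m - (U_(i) + U_(j) + (U_(a) + U_(b)))]
    * ('X_i * 'X_j * ('X_a * 'X_b)) :> {mpoly k[n]}.
  by rewrite XE -mpolyXD submK.
have [_ _ JM] : is_ideal (ideal_pow (edge_ideal k H) 2).
  exact: ideal_gen_is_ideal.
apply/JM/ideal_gen_mem; exists ('X_i * 'X_j), ('X_a * 'X_b).
split=> //; first by apply: ideal_gen_mem; exists i, j.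
(* The extra factor 1 comes from the zeroth power, which is the whole ring. *)
rewrite -[_ * _]mulr1; apply: ideal_gen_mem; exists ('X_a * 'X_b), 1.
by split=> //; apply: ideal_gen_mem; exists a, b.
Qed.

(** Each polynomial is split as $f_0+f_1$, with $f_0$ free of the variables of $C$ and $f_1\in P_C$.
    If $fg\in P_C$ then $f_0g_0\in P_C$, yet no monomial of $f_0g_0$ involves $C$; so $f_0g_0=0$,
    and one factor vanishes. *)
Lemma variable_ideal_prime (k : fieldType) n (C : {set 'I_n}) :
  prime_ideal (variable_ideal k C).
Proof.
split=> [||f g].
- exact: ideal_gen_is_ideal.
- move/variable_idealE; rewrite msupp1 /= andbT => /exists_inP[i _].
  by rewrite mnm0E.
have dec (h : {mpoly k[n]}) : exists h0 h1, [/\ h = h0 + h1,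
    all (predC (meets C)) (msupp h0) & variable_ideal k C h1].
  exists (\sum_(m <- msupp h | ~~ meets C m) h@_m *: 'X_[m]).
  exists (\sum_(m <- msupp h | meets C m) h@_m *: 'X_[m]); split.
  - by rewrite {1}[h]mpolyE (bigID (meets C)) addrC.
  - apply/allP => m /msupp_sum_le /flattenP[/= s /mapP[m'] /[!mem_filter]].
    by case/andP=> nC _ -> /msuppZ_le /[!msuppX] /[!inE] /eqP ->.
  apply: ideal_sum => [|m _ Cm]; first exact: ideal_gen_is_ideal.
  apply/variable_idealE/allP => m'.
  by move/msuppZ_le; rewrite msuppX inE => /eqP ->.
have [_ PD PM] : is_ideal (variable_ideal k C) by apply: ideal_gen_is_ideal.
move=> Pfg; have [f0 [f1 [Df f0C Pf1]]] := dec f.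
have [g0 [g1 [Dg g0C Pg1]]] := dec g.
have : variable_ideal k C (f0 * g0).
  have -> : f0 * g0 = f * g + ((- g) * f1 + (- f0) * g1).
    by rewrite Df Dg; ring.
  by apply/(PD _ _ Pfg)/PD; apply: PM.
move/variable_idealE/allP => Mfg.
have nMfg : all (predC (meets C)) (msupp (f0 * g0)).
  apply: (all_msuppM _ f0C g0C) => m1 m2 /exists_inPn n1 /exists_inPn n2.
  apply/exists_inPn => i iC; have:= n1 i iC; have:= n2 i iC.
  by rewrite mnmDE addn_eq0 => /negPn -> /negPn ->.
have /eqP : f0 * g0 = 0.
  apply/eqP; rewrite -msupp_eq0; case: (msupp _) Mfg nMfg => //= m s Mm.
  by rewrite Mm ?mem_head.
by rewrite mulf_eq0 Df Dg => /orP[]/eqP ->; rewrite add0r; [left|right].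
Qed.

(** A witness [f] is replaced by a single monomial of $x^uf$, where $x^u$ consists of the squares of
    the variables outside $C$. Conversely, these large exponents ensure that multiplying $x^m$ by a
    monomial free of $C$ cannot bring it into $I^2$. *)
Lemma associated_square_variable_idealP (k : fieldType) n
    (H : {set {set 'I_n}}) (C : {set 'I_n}) :
  is_graph H ->
  associated_prime (ideal_pow (edge_ideal k H) 2) (variable_ideal k C) <->
  exists m : 'X_{1..n},
    [/\ forall i, i \notin C -> (2 <= m i)%N, ~~ two_edges_le H m
      & forall i, i \in C -> two_edges_le H (m + U_(i))%MM].
Proof.
move=> gH; split=> [[_ [f Pf]]|[m [mD nHm Hm]]].
  (* As $x^u$ is outside $P_C$, the product $x^uf$ is outside $I^2$ and so has a monomial outside
     $I^2$. *)
  pose u : 'X_{1..n} := [multinom (if i \in C then 0 else 2)%N | i < n].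
  have nPu : ~ variable_ideal k C 'X_[u].
    move/variable_idealE; rewrite msuppX /= andbT => /exists_inP[i iC].
    by rewrite mnmE iC.
  have : ~~ all (fun m => two_edges_le H (u + m)%MM) (msupp f).
    apply/negP => Hf; apply/nPu/Pf/edge_ideal_squareE.
    apply: (all_msuppM (M1 := pred1 u) _ _ Hf) => [_ m2 /eqP ->//|].
    by rewrite msuppX /= eqxx.
  case/allPn => m mf nHum; exists (u + m)%MM; split=> // i iC.
    by rewrite mnmDE mnmE (negPf iC) leq_addr.
  have /Pf /edge_ideal_squareE /allP HXf : variable_ideal k C 'X_i.
    by apply: ideal_gen_mem; exists i.
  have : (m + U_(i))%MM \in msupp ('X_i * f).
    by rewrite mcoeff_msupp mulrC addmC mcoeffMX -mcoeff_msupp.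
  move=> /HXf; apply: two_edges_leS => x.
  by rewrite !mnmDE -addnA leq_addl.
split; first exact: variable_ideal_prime.
exists 'X_[m] => g; split=> [/variable_idealE Cg|/edge_ideal_squareE /allP Hgm].
  apply/edge_ideal_squareE/(all_msuppM _ Cg (M2 := pred1 m)).
    move=> w _ /exists_inP[i iC wi] /eqP ->; move: (Hm i iC).
    apply: two_edges_leS => x; rewrite !mnmDE mnm1E addnC leq_add2r.
    by case: eqP => // <-; rewrite lt0n.
  by rewrite msuppX /= eqxx.
apply/variable_idealE/allP => w wg; have : (m + w)%MM \in msupp (g * 'X_[m]).
  by rewrite mcoeff_msupp mcoeffMX -mcoeff_msupp.
move=> /Hgm Hmw; apply: contraNT nHm => /exists_inPn wC.
have /two_edges_leP[i [j [a [b [ij ab le_mw]]]]] := Hmw.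
apply/two_edges_leP; exists i, j, a, b; split=> // x.
have [xC|xC] := boolP (x \in C).
  have := le_mw x; have /negPn/eqP := wC x xC; rewrite mnmDE => ->.
  by rewrite addn0.
apply: leq_trans (mD x xC) => {le_mw}.
(* An edge has two distinct ends, so two edges use [x] at most twice. *)
have pair_le1 c d : adjacent H c d -> ((c == x) + (d == x) <= 1)%N.
  move=> /(adjacent_neq gH); case: (eqVneq c x) => [->|_ _]; last exact: leq_b1.
  by rewrite eq_sym => /negPf ->.
by rewrite -addnA (leq_add (pair_le1 _ _ ij) (pair_le1 _ _ ab)).
Qed.

(** * Exponent combinatorics of a monomial outside $I^2$ *)

Definition edge_and_vertex_le n (H : {set {set 'I_n}}) (m : 'X_{1..n})
    (j : 'I_n) : Prop :=
  exists k l, adjacent H k l /\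
    forall x, ((j == x) + (k == x) + (l == x) <= m x)%N.

(** Two edges dividing $x_ix^m$ must use [i], since they do not divide $x^m$. Cancelling one copy of
    [i] leaves its partner [j] and the other edge. *)
Lemma two_edges_le_mnmDU n (H : {set {set 'I_n}}) (m : 'X_{1..n}) i :
    ~~ two_edges_le H m ->
  two_edges_le H (m + U_(i))%MM <->
  exists2 j, adjacent H i j & edge_and_vertex_le H m j.
Proof.
move=> nHm; split=> [/two_edges_leP|[j ij [k [l [kl le_m]]]]]; last first.
  apply/two_edges_leP; exists i, j, k, l; split=> // x.
  by have := le_m x; rewrite mnmDE mnm1E; clear; lia.
move=> [a [b [c [d [ab cd le_mU]]]]].
have {}le_mU x :
    ((a == x) + (b == x) + (c == x) + (d == x) <= m x + (i == x))%N.
  by have := le_mU x; rewrite mnmDE mnm1E.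
have [ia|nia] := eqVneq a i.
  rewrite ia in ab le_mU; exists b => //; exists c, d; split=> // x.
  by have := le_mU x; clear; lia.
have [ib|nib] := eqVneq b i.
  rewrite ib in ab le_mU; exists a; first by rewrite adjacent_sym.
  by exists c, d; split=> // x; have := le_mU x; clear; lia.
have [ic|nic] := eqVneq c i.
  rewrite ic in cd le_mU; exists d => //; exists a, b; split=> // x.
  by have := le_mU x; clear; lia.
have [id|nid] := eqVneq d i.
  rewrite id in cd le_mU; exists c; first by rewrite adjacent_sym.
  by exists a, b; split=> // x; have := le_mU x; clear; lia.
case/negP: nHm; apply/two_edges_leP; exists a, b, c, d; split=> // x.
have := le_mU x; have [<-|_] := eqVneq i x; last by rewrite addn0.
by rewrite (negPf nia) (negPf nib) (negPf nic) (negPf nid).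
Qed.

Lemma triangle_in_socle n (H : {set {set 'I_n}}) (m : 'X_{1..n}) t :
    is_graph H -> ~~ two_edges_le H m -> two_edges_le H (m + U_(t))%MM ->
    edge_and_vertex_le H m t ->
  exists j q, [/\ adjacent H t j, adjacent H t q, adjacent H j q
    & [/\ m t = 1, m j = 1 & m q = 1]%N].
Proof.
move=> gH nHm /(two_edges_le_mnmDU _ nHm)[j tj [p [q [pq le_jpq]]]].
move=> [k [l [kl le_tkl]]].
have twoN a b c d : adjacent H a b -> adjacent H c d ->
    (forall x, (a == x) + (b == x) + (c == x) + (d == x) <= m x)%N -> False.
  by move=> ab cd le_m; case/negP: nHm; apply/two_edges_leP; exists a, b, c, d.
have mt1 : (1 <= m t)%N by have := le_tkl t; rewrite eqxx; clear; lia.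
have ntj := adjacent_neq gH tj.
(* If the edge [pq] missed [t], then [tj] and [pq] together would divide $x^m$, because [m t] is
   positive. *)
wlog pt : p q pq le_jpq / p = t.
  move=> IH; have [/(IH _ _ pq)|npt] := eqVneq p t; first exact.
  have [/(IH q p) |nqt] := eqVneq q t.
    by rewrite adjacent_sym; apply=> // x; have := le_jpq x; clear; lia.
  case: (twoN _ _ _ _ tj pq) => x; have := le_jpq x.
  have [<-|_] := eqVneq t x; last by clear; lia.
  by rewrite (eq_sym j) (negPf ntj) (negPf npt) (negPf nqt).
rewrite {p}pt in pq le_jpq; have ntq := adjacent_neq gH pq.
(* With exponent 2 at [t], the edges [tj] and [tq] would together divide $x^m$. *)
have mt : m t = 1%N.
  apply/eqP; rewrite eqn_leq mt1 andbT leqNgt; apply/negP => mt2.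
  apply: (twoN _ _ _ _ tj pq) => x; have := le_jpq x.
  have [<-|_] := eqVneq t x; last by clear; lia.
  by rewrite (eq_sym j) (negPf ntj) (eq_sym q) (negPf ntq).
have nkt : k != t.
  by apply/eqP => kt; have := le_tkl t; rewrite mt kt eqxx; clear; lia.
have nlt : l != t.
  by apply/eqP => lt; have := le_tkl t; rewrite mt lt eqxx; clear; lia.
have nkl := adjacent_neq gH kl.
(* Otherwise the edges [tv] and [kl] would together divide $x^m$. Applied to [j] and [q], this
   identifies them with the two ends of [kl], which closes the triangle. *)
have key v : adjacent H t v -> (0 < m v)%N ->
    ((v == k) || (v == l)) /\ m v = 1%N.
  move=> tv mv; have ntv := adjacent_neq gH tv.
  have mvN : ~ ((k == v) + (l == v) < m v)%N.
    move=> mv2; apply: (twoN _ _ _ _ tv kl) => x; have := le_tkl x.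
    have [<-|_] := eqVneq v x; last by clear; lia.
    by rewrite (negPf ntv).
  rewrite ![v == _]eq_sym; have [kv|nkv] := eqVneq k v.
    split=> //; move: nkl mv mvN; rewrite -kv (eq_sym k l) eqxx.
    by move=> /negPf ->; clear; lia.
  by move: mv mvN; rewrite (negPf nkv); case: eqP => _ /=; clear; lia.
have mj : (0 < m j)%N by have := le_jpq j; rewrite eqxx; clear; lia.
have mq : (0 < m q)%N by have := le_jpq q; rewrite eqxx; clear; lia.
have [jkl mj1] := key j tj mj; have [qkl mq1] := key q pq mq.
have njq : j != q.
  by apply/eqP => jq; have := le_jpq q; rewrite mq1 jq eqxx; clear; lia.
exists j, q; split=> //.
case/orP: jkl njq => /eqP ->; case/orP: qkl => /eqP ->; rewrite ?eqxx //.
by rewrite adjacent_sym.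
Qed.

(** * Minimal covers and triangles *)

(** A vertex of $C\setminus S$ cannot be dropped exactly when some edge meets $C$ in that vertex
    alone, that is, when its other end lies outside $C$. *)
Lemma minimal_cover_containingE n (H : {set {set 'I_n}}) (S C : {set 'I_n}) :
    is_graph H -> is_cover H C ->
  minimal_cover_containing H S C = (S \subset C) &&
    [forall i in C :\: S, [exists d, (d \notin C) && adjacent H i d]].
Proof.
move=> gH hC; apply/minsetP/andP => [[/andP[_ SC] minC]|[SC /forall_inP outC]].
  split=> //; apply/forall_inP => i /setDP[iC niS].
  have : ~~ is_cover H (C :\ i).
    apply/negP => hCi; have : C :\ i = C.
      by apply: minC; rewrite ?subD1set // hCi subsetD1 SC niS.
    by move/setP/(_ i); rewrite !inE eqxx iC.
  case/forall_inPn => e eH /negPn/eqP Ci0.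
  have /set0Pn[x /setIP[xC xe]] := forall_inP hC e eH.
  have xi : x = i.
    apply/eqP/negPn/negP => nxi; move/setP/(_ x): Ci0.
    by rewrite !inE nxi xC xe.
  rewrite xi in xe => {x xC xi}.
  have /cards2P[a [b [nab De]]] := forall_inP gH e eH.
  wlog Dai : a b nab De / a = i.
    move=> IH; move: (xe); rewrite De => /set2P[ia|ib]; first exact: (IH a b).
    by apply: (IH b a); rewrite 1?eq_sym 1?setUC.
  rewrite {a}Dai in nab De; apply/existsP; exists b.
  rewrite /adjacent -De eH andbT.
  apply/negP => bC; move/setP/(_ b): Ci0.
  by rewrite !inE eq_sym nab bC De !inE eqxx orbT.
split=> [|B /andP[hB SB] BC]; first by rewrite hC.
apply/eqP; rewrite eqEsubset BC; apply/subsetP => i iC.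
have [/(subsetP SB) //|niS] := boolP (i \in S).
have /existsP[d /andP[ndC id]] : [exists d, (d \notin C) && adjacent H i d].
  by apply: outC; rewrite inE niS.
have /set0Pn[x /setIP[xB /set2P[<- //|xd]]] := forall_inP hB _ id.
by rewrite -xd (subsetP BC) in ndC.
Qed.

Lemma minimal_coverE n (H : {set {set 'I_n}}) (C : {set 'I_n}) :
    is_graph H -> is_cover H C ->
  minimal_cover H C =
    [forall i in C, [exists d, (d \notin C) && adjacent H i d]].
Proof.
move=> gH hC; have := minimal_cover_containingE set0 gH hC.
rewrite sub0set setD0 andTb => <-; apply: minset_eq => D.
by rewrite sub0set andbT.
Qed.

Lemma is_triangleP n (H : {set {set 'I_n}}) (U : {set 'I_n}) :
    is_graph H ->
  reflect (exists t j q, [/\ U = [set t; j; q], adjacent H t j, adjacent H t q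
                            & adjacent H j q])
    (is_triangle H U).
Proof.
move=> gH; apply: (iffP andP) => [[cU /forall_inP aU]|].
  have /card_gt0P[t tU] : (0 < #|U|)%N by rewrite (eqP cU).
  have /cards2P[j [q [njq DUt]]] : #|U :\ t| == 2.
    by move: cU; rewrite (cardsD1 t) tU.
  have DU : U = [set t; j; q] by rewrite -(setD1K tU) DUt setUA.
  have adjU a b : a \in U -> b \in U -> a != b -> adjacent H a b.
    by move=> /aU /forall_inP aUa /aUa /implyP; apply.
  have /setD1P[njt jU] : j \in U :\ t by rewrite DUt set21.
  have /setD1P[nqt qU] : q \in U :\ t by rewrite DUt set22.
  by exists t, j, q; split=> //; apply: adjU => //; rewrite eq_sym.
move=> [t [j [q [-> tj tq jq]]]].
have [ntj ntq njq] := And3 (adjacent_neq gH tj) (adjacent_neq gH tq)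
  (adjacent_neq gH jq).
split.
  by rewrite -setUA cardsU1 cards2 !inE negb_or ntj ntq njq.
apply/forall_inP => a aU; apply/forall_inP => b bU; apply/implyP.
move: aU bU; rewrite !inE -!orbA.
move=> /or3P[]/eqP-> /or3P[]/eqP->; rewrite ?eqxx //= => _ //;
  by rewrite adjacent_sym.
Qed.

Lemma triangle_edge_avoiding n (H : {set {set 'I_n}}) (U : {set 'I_n}) x :
    is_graph H -> is_triangle H U ->
  exists v w, [/\ v \in U, w \in U, adjacent H v w, v != x & w != x].
Proof.
move=> gH /(is_triangleP _ gH)[t [j [q [-> tj tq jq]]]].
have [ntj ntq njq] := And3 (adjacent_neq gH tj) (adjacent_neq gH tq)
  (adjacent_neq gH jq).
have [->|ntx] := eqVneq x t.
  by exists j, q; split; rewrite ?inE ?eqxx ?orbT // eq_sym.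
have [->|njx] := eqVneq x j.
  by exists t, q; split; rewrite ?inE ?eqxx ?orbT // eq_sym.
by exists t, j; split; rewrite ?inE ?eqxx ?orbT // eq_sym.
Qed.

(** Disjoint edges have four distinct ends, so positive exponents suffice. *)
Lemma disjoint_edges_le n (H : {set {set 'I_n}}) (m : 'I_n -> nat) a b v w :
    is_graph H -> adjacent H a b -> adjacent H v w ->
    v \notin [set a; b] -> w \notin [set a; b] ->
    [/\ 0 < m a, 0 < m b, 0 < m v & 0 < m w]%N ->
  two_edges_le H m.
Proof.
move=> gH ab vw nv nw [ma mb mv mw].
apply/two_edges_leP; exists a, b, v, w; split=> // x.
move: nv nw; rewrite !inE !negb_or => /andP[nva nvb] /andP[nwa nwb].
have nab := adjacent_neq gH ab; have nvw := adjacent_neq gH vw.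
have [<-|nax] := eqVneq a x.
  by rewrite (eq_sym b) (negPf nab) (negPf nva) (negPf nwa).
have [<-|nbx] := eqVneq b x; first by rewrite (negPf nvb) (negPf nwb).
have [<-|_] := eqVneq v x; first by rewrite (eq_sym w) (negPf nvw).
by case: eqP => // <-.
Qed.

(** * From the monomial to the cover, and back *)

Lemma associated_monomial_minimal n (H : {set {set 'I_n}}) (C : {set 'I_n})
    (m : 'X_{1..n}) :
    is_graph H -> is_cover H C ->
    (forall i, i \notin C -> (2 <= m i)%N) -> ~~ two_edges_le H m ->
    (forall i, i \in C -> two_edges_le H (m + U_(i))%MM) ->
  minimal_cover H C \/
  exists U : {set 'I_n},
    is_triangle H U /\ minimal_cover_containing H (neighborhood H U) C.
Proof.
move=> gH hC mD nHm Hm.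
(* The neighbour [t] through which [i] satisfies the condition is itself in $C$, so the condition at
   [t] yields a triangle. *)
have inner_triangle i : i \in C ->
    ~~ [exists d, (d \notin C) && adjacent H i d] ->
    exists t j q, [/\ adjacent H i t, adjacent H t j, adjacent H t q,
      adjacent H j q & [/\ m t = 1, m j = 1 & m q = 1]%N].
  move=> iC /existsPn niD; have := Hm i iC.
  case/(two_edges_le_mnmDU _ nHm) => t it mt.
  have tC : t \in C by have := niD t; rewrite it andbT negbK.
  have [j [q [tj tq jq m1]]] := triangle_in_socle gH nHm (Hm t tC) mt.
  by exists t, j, q.
have [|nminC] := boolP (minimal_cover H C); [by left|right].
move: nminC; rewrite minimal_coverE // => /forall_inPn[i iC niD].
have [t [j [q [_ tj tq jq [mt mj mq]]]]] := inner_triangle i iC niD.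
pose U := [set t; j; q]; have triU : is_triangle H U.
  by apply/is_triangleP => //; exists t, j, q.
have mU u : u \in U -> m u = 1%N by rewrite !inE -orbA => /or3P[]/eqP->.
(* If [a] is outside [U], the edge of [U] avoiding [b] is disjoint from [ab], and the two put $x^m$
   in $I^2$. By symmetry every edge of the support lies inside [U]. *)
have edgeU a b : adjacent H a b -> (0 < m a)%N -> (0 < m b)%N -> a \in U.
  move=> ab ma mb; apply: contraT => naU.
  have [v [w [vU wU vw nvb nwb]]] := triangle_edge_avoiding b gH triU.
  have nUa u : u \in U -> u != a by apply: contraTneq => ->.
  case/negP: nHm; apply: (disjoint_edges_le gH ab vw).
  - by rewrite !inE negb_or nvb nUa.
  - by rewrite !inE negb_or nwb nUa.
  by rewrite ma mb !mU.
exists U; split=> //; rewrite minimal_cover_containingE //; apply/andP; split.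
  (* A neighbour of [U] outside $C$ has exponent at least 2, but [edgeU] places it in [U], where
     exponents are 1. *)
  apply/subsetP => d; rewrite inE => /exists_inP[u uU].
  rewrite adjacent_sym => du; apply: contraT => ndC; have md := mD d ndC.
  have dU : d \in U by apply: (edgeU d u du); [apply: ltnW|rewrite mU].
  by rewrite mU in md.
(* Without a neighbour outside $C$, [i'] is adjacent to a vertex [t'] of a triangle in the support;
   [edgeU] puts [t'] in [U]. *)
apply/forall_inP => i' /setDP[i'C]; apply: contraNT => ni'D.
have [t' [j' [_ [i't' t'j' _ _ [mt' mj' _]]]]] := inner_triangle i' i'C ni'D.
rewrite inE; apply/exists_inP; exists t'; last by rewrite adjacent_sym.
by apply: edgeU t'j' _ _; rewrite ?mt' ?mj'.
Qed.

Lemma minimal_cover_monomial n (H : {set {set 'I_n}}) (C : {set 'I_n}) :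
    is_graph H -> is_cover H C -> minimal_cover H C ->
  exists m : 'X_{1..n},
    [/\ forall i, i \notin C -> (2 <= m i)%N, ~~ two_edges_le H m
      & forall i, i \in C -> two_edges_le H (m + U_(i))%MM].
Proof.
move=> gH hC; rewrite minimal_coverE // => /forall_inP minC.
have edgeC a b : adjacent H a b -> (a \in C) || (b \in C).
  move=> /(forall_inP hC)/set0Pn[x /setIP[xC /set2P[]xab]];
    by rewrite -xab xC ?orbT.
(* An empty cover means that there are no edges, so $I=0$ and any monomial with exponents at least 2
   serves. *)
have [C0|[c cC]] := set_0Vmem C.
  exists [multinom 2%N | i < n]; split=> [i _||i]; rewrite ?C0 ?inE ?mnmE //.
  apply/two_edges_leP => -[a [b [k [l [/edgeC]]]]].
  by rewrite C0 !inE.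
pose m : 'X_{1..n} :=
  [multinom (if i \in C then (i == c : nat) else 2)%N | i < n].
have mC x : x \in C -> m x = (c == x) by rewrite mnmE eq_sym => ->.
have mD x : x \notin C -> m x = 2 by rewrite mnmE => /negPf ->.
have nHm : ~~ two_edges_le H m.
  apply/two_edges_leP => -[a [b [k [l [ab kl le_m]]]]].
  (* Every edge has an end in $C$, where only [c] has a nonzero exponent; so both edges would pass
     through [c], whose exponent is 1. *)
  have edge_c u v : adjacent H u v ->
      (forall x, (u == x) + (v == x) <= m x)%N -> (1 <= (u == c) + (v == c))%N.
    move=> /edgeC + le_uv; case/orP=> [uC|vC].
      have := le_uv u; rewrite mC // eqxx (eq_sym u c).
      by case: (c == u); clear; lia.
    have := le_uv v; rewrite mC // eqxx (eq_sym v c).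
    by case: (c == v); clear; lia.
  have abc : (1 <= (a == c) + (b == c))%N.
    by apply: edge_c ab _ => x; have := le_m x; clear; lia.
  have klc : (1 <= (k == c) + (l == c))%N.
    by apply: edge_c kl _ => x; have := le_m x; clear; lia.
  by have := le_m c; rewrite mC // eqxx; move: abc klc; clear; lia.
exists m; split=> // [x /mD -> //|i iC]; apply/(two_edges_le_mnmDU _ nHm).
have /existsP[d /andP[ndC id]] := minC i iC.
have /existsP[e /andP[neC ce]] := minC c cC.
(* The edges [id] and [ce] work; [d] and [e] may coincide, since exponents outside $C$ are 2. *)
exists d => //; exists c, e; split=> // x; have [xC|nxC] := boolP (x \in C).
  have nx y : y \notin C -> (y == x) = false.
    by apply: contraNF => /eqP ->.
  by rewrite mC // (nx d) // (nx e) // addn0.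
rewrite mD //; have -> : (c == x) = false by apply: contraNF nxC => /eqP <-.
by rewrite addn0 (leq_add (leq_b1 _) (leq_b1 _)).
Qed.

Lemma triangle_cover_monomial n (H : {set {set 'I_n}}) (C U : {set 'I_n}) :
    is_graph H -> is_cover H C -> is_triangle H U ->
    minimal_cover_containing H (neighborhood H U) C ->
  exists m : 'X_{1..n},
    [/\ forall i, i \notin C -> (2 <= m i)%N, ~~ two_edges_le H m
      & forall i, i \in C -> two_edges_le H (m + U_(i))%MM].
Proof.
move=> gH hC triU; rewrite minimal_cover_containingE //.
move=> /andP[/subsetP NC /forall_inP minC].
have edgeC a b : adjacent H a b -> (a \in C) || (b \in C).
  move=> /(forall_inP hC)/set0Pn[x /setIP[xC /set2P[]xab]];
    by rewrite -xab xC ?orbT.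
have UC u : u \in U -> u \in C.
  move=> uU; apply: NC; rewrite inE; apply/exists_inP.
  have [cU /forall_inP aU] := andP triU.
  have [v [w [vU wU vw nvu nwu]]] := triangle_edge_avoiding u gH triU.
  by exists v => //; apply: (implyP (forall_inP (aU v vU) u uU)).
pose m : 'X_{1..n} :=
  [multinom (if i \in C then (i \in U : nat) else 2)%N | i < n].
have mC x : x \in C -> m x = (x \in U) by rewrite mnmE => ->.
have mD x : x \notin C -> m x = 2 by rewrite mnmE => /negPf ->.
(* If [a] is outside $C$, then [b] is in $C$, hence in [U] by positivity; so [a] is in
   $N(U)\subseteq C$, a contradiction. *)
have edgeU a b : adjacent H a b -> (0 < m a)%N -> (0 < m b)%N -> a \in U.
  wlog aC : a b / a \in C => [IH ab ma mb|ab + _]; last by rewrite mC // lt0b.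
  have [aC|naC] := boolP (a \in C); first exact: (IH a b).
  have bC : b \in C by have := edgeC a b ab; rewrite (negPf naC).
  have bU : b \in U by move: mb; rewrite mC // lt0b.
  by case/negP: naC; apply: NC; rewrite inE; apply/exists_inP; exists b;
    rewrite // adjacent_sym.
have nHm : ~~ two_edges_le H m.
  apply/two_edges_leP => -[a [b [k [l [ab kl le_m]]]]].
  have pos u v w z :
      (forall x, (u == x) + (v == x) + (w == x) + (z == x) <= m x)%N ->
      [/\ 0 < m u, 0 < m v, 0 < m w & 0 < m z]%N.
    by move=> le_u; split; apply: leq_trans (le_u _); rewrite eqxx; clear; lia.
  have [ma mb mk ml] := pos _ _ _ _ le_m.
  have sum1 u : u \in U -> (\sum_(x in U) (u == x) = 1)%N.
    move=> uU; rewrite (bigD1 u) //= eqxx big1 // => x /andP[_].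
    by rewrite eq_sym => /negPf ->.
  (* Degree count over [U]: two edges inside [U] contribute 4, while $x^m$ has degree only 3
     there. *)
  have : (\sum_(x in U) ((a == x) + (b == x) + (k == x) + (l == x))
           <= \sum_(x in U) 1)%N.
    apply: leq_sum => x xU; apply: leq_trans (le_m x) _.
    by rewrite mC ?UC // xU.
  have [ba lk] : adjacent H b a /\ adjacent H l k.
    by rewrite (adjacent_sym _ b) (adjacent_sym _ l).
  rewrite !big_split /= !sum1 ?(edgeU a b) ?(edgeU b a) ?(edgeU k l) //;
    last exact: (edgeU l k).
  by rewrite sum1_card; case/andP: triU => /eqP ->.
(* The edge of [U] avoiding [j] fits beside [j]: for [j] in [U] the three vertices are distinct, and
   outside $C$ there is room for [j]. *)
have evl j : (j \in U) || (j \notin C) -> edge_and_vertex_le H m j.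
  move=> jUC.
  have [v [w [vU wU vw nvj nwj]]] := triangle_edge_avoiding j gH triU.
  exists v, w; split=> // x; have nvw := adjacent_neq gH vw.
  have [<-|nvx] := eqVneq v x.
    by rewrite (eq_sym j) (negPf nvj) (eq_sym w) (negPf nvw) mC ?UC // vU.
  have [<-|nwx] := eqVneq w x.
    by rewrite (eq_sym j) (negPf nwj) mC ?UC // wU.
  have [<-|//] := eqVneq j x.
  have [jC|njC] := boolP (j \in C); last by rewrite mD.
  by move: jUC; rewrite jC orbF mC // => ->.
exists m; split=> // [x /mD -> //|i iC]; apply/(two_edges_le_mnmDU _ nHm).
have [iN|niN] := boolP (i \in neighborhood H U).
  move: iN; rewrite inE => /exists_inP[u uU ui].
  by exists u; [rewrite adjacent_sym|apply: evl; rewrite uU].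
have /existsP[d /andP[ndC id]] : [exists d, (d \notin C) && adjacent H i d].
  by apply: minC; rewrite inE niN.
by exists d => //; apply: evl; rewrite ndC orbT.
Qed.

Theorem theorem3p8 (k : fieldType) (n : nat) (H : {set {set 'I_n}})
    (hH : is_graph H) (C : {set 'I_n}) (hC : is_cover H C) :
  associated_prime (ideal_pow (edge_ideal k H) 2) (variable_ideal k C) <->
  minimal_cover H C \/
  exists U : {set 'I_n},
    is_triangle H U /\ minimal_cover_containing H (neighborhood H U) C.
Proof.
apply: (iff_trans (associated_square_variable_idealP k C hH)).
split=> [[m [mD nHm Hm]]|[minC|[U [triU minC]]]].
- exact: associated_monomial_minimal mD nHm Hm.
- exact: minimal_cover_monomial.
exact: triangle_cover_monomial triU minC.
Qed.
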